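(* Let $X$ be an object in a cartesian tangent category with scalar $R$-multiplication. Let $(\mathcal{X}(X),\Omega(X),d,\iota)$ be a Cartan calculus (in the sense of the abstract definition recalled in the context), where $\mathcal{X}(X)$ is the Lie algebra of vector fields on $X$. Then there is a unique morphism of graded $\mathcal{O}_X$-algebras $\psi:\Omega(X)\to\Omega_{\mathrm{LR}}(X)$ such that $$\psi(d\omega)=d_{\mathrm{LR}}\big(\psi(\omega)\big),\qquad \psi(\iota_v\omega)=\iota^{\mathrm{LR}}_v\big(\psi(\omega)\big)$$ for all $\omega\in\Omega(X)$ and $v\in\mathcal{X}(X)$.
   Context: **Conventions.** Composition of functors is juxtaposition; $(\pi T)_X=\pi_{TX}$, $(T\pi)_X=T(\pi_X)$, etc. $(f,g)$ is the morphism into a (fiber) product with components $f,g$. **Rosický tangent structure** on $\mathcal{C}$: a functor $T:\mathcal{C}\to\mathcal{C}$ and natural transformations $\pi:T\to 1$, $0:1\to T$, $+:T_2\to T$, $\lambda:T\to T^2$, $\tau:T^2\to T^2$ such that (i) for all $X$, $k\ge1$ the $k$-fold fiber product $T_kX=TX\times_X\cdots\times_X TX$ of $\pi_X$ exists and is preserved by $T$: the natural map $\nu_{k,X}:T(T_kX)\to T^2X\times_{TX}\cdots\times_{TX}T^2X$ (fiber product over $T\pi_X$) is an isomorphism; (ii) $\pi:T\to1$ with $0,+$ is a bundle of abelian groups (each $TX\to X$ is an abelian group object over $X$, naturally in $X$); $-:T_2\to T$ denotes the difference; (iii) $\tau\circ\tau=\mathrm{id}$, $\tau T\circ T\tau\circ\tau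 T=T\tau\circ\tau T\circ T\tau$, $\pi T\circ\tau=T\pi$, $\tau\circ T{+}\circ\nu_2^{-1}=(+T)\circ(\tau\times_T\tau)$; (iv) $\pi T\circ\lambda=0\circ\pi$, $\lambda T\circ\lambda=T\lambda\circ\lambda$, $(+T)\circ(\lambda\times_0\lambda)=\lambda\circ{+}$; (v) $\tau\circ\lambda=\lambda$, $T\tau\circ\tau T\circ T\lambda=\lambda T\circ\tau$; (vi) the square with top $\lambda:T\to T^2$, left $\pi:T\to1$, right $(\pi T,T\pi):T^2\to T_2$, bottom $(0,0):1\to T_2$ is a pointwise pullback. Put $\lambda_2:=\tau\circ(+T)\circ(T0\times_0\lambda):T_2\to T^2$. **Cartesian:** $\mathcal{C}$ has finite products and $T$ preserves them; we identify $T(X\times Y)=TX\times TY$. For $f:X\times Y\to Z$ put $T_{(1)}f=Tf\circ(\mathrm{id}_{TX}\times0_Y)$, $T_{(2)}f=Tf\circ(0_X\times\mathrm{id}_{TY})$. **Scalar $R$-multiplication:** $R$ is a commutative ring object (addition $\hat+$, zero $\hat0$, multiplication $\hat m$, unit $\hat1$) and $\kappa_X:R\times TX\to TX$ is natural in $X$, is a morphism over $X$, and makes $TX\to X$ a bundle of $R$-modules (associative, unital, additive in $R$ and in $TX$). $R$ is tangent-stable: there is an isomorphism $(\pi_R,\eta_R):TR\cong R\times R$ of bundles of $R$-modules over $R$; its fiber projection $\eta_R:TR\to R$ satisfies $\eta_R\circ{+_R}=\hat+\circ(\eta_R\times\eta_R)$, $\eta_R\circ0_R=\hat0$, $\eta_R\circ\kappa_R=\hat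 m\circ(\mathrm{id}_R\times\eta_R)$, $\eta_R\circ T\hat+=\hat+\circ(\eta_R\times\eta_R)$, $\eta_R\circ T\eta_R\circ\lambda_R=\eta_R$. Moreover, for all $X$: $\kappa_{TX}\circ(\mathrm{id}_R\times\lambda_X)=\lambda_X\circ\kappa_X$; $T_{(1)}\kappa_X=(\lambda_2)_X\circ\big(\kappa_X\circ(\mathrm{pr}_1,\mathrm{pr}_3),\kappa_X\circ(\mathrm{pr}_2,\mathrm{pr}_3)\big)\circ\big((\pi_R,\eta_R)\times\mathrm{id}_{TX}\big)$; $T_{(2)}\kappa_X=\tau_X\circ\kappa_{TX}\circ(\mathrm{id}_R\times\tau_X)$. **Functions and vector fields.** $\mathcal{O}_X=\mathrm{Hom}(X,R)$ with its pointwise ring structure. $\mathcal{X}(X)$ is the set of sections of $\pi_X$, an $\mathcal{O}_X$-module by $v+w={+_X}\circ(v,w)$, $fv=\kappa_X\circ(f,v)$, with Lie bracket $[v,w]$ the unique vector field such that $-_{TX}\circ(Tw\circ v,\tau_X\circ Tv\circ w)=(\lambda_2)_X\circ(w,[v,w])$. It acts on $\mathcal{O}_X$ by the derivations $v\cdot f=\eta_R\circ Tf\circ v$. **Cartan calculus:** a commutative differential graded algebra $(\Omega,d)$, an $\Omega^0$-module $\mathcal{X}$ with a Lie bracket, and for every $v\in\mathcal{X}$ a graded derivation $\iota_v$ of $\Omega$ of degree $-1$, such that $\iota_{v+w}=\iota_v+\iota_w$, $\iota_{fv}\omega=f\wedge\iota_v\omega$, and, with $\mathcal{L}_v:=[\iota_v,d]$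 (graded commutators), $[\iota_v,\iota_w]=0$, $[\mathcal{L}_v,\iota_w]=\iota_{[v,w]}$, $[\mathcal{L}_v,\mathcal{L}_w]=\mathcal{L}_{[v,w]}$, $[\mathcal{L}_v,d]=0$ for all $v,w\in\mathcal{X}$, $f\in\Omega^0$, $\omega\in\Omega$. **Lie-Rinehart forms.** $\Omega^n_{\mathrm{LR}}(X)=\mathrm{Hom}_{\mathcal{O}_X}(\wedge^n_{\mathcal{O}_X}\mathcal{X}(X),\mathcal{O}_X)$, a commutative graded $\mathcal{O}_X$-algebra under the usual wedge product $(\alpha\wedge\beta)(v_1,\dots,v_{p+q})=\sum\pm\alpha(v_{i_1},\dots,v_{i_p})\beta(v_{j_1},\dots,v_{j_q})$, summed over all partitions $\{i_1<\dots<i_p\}\sqcup\{j_1<\dots<j_q\}=\{1,\dots,p+q\}$ with the sign of the corresponding permutation; with the Chevalley-Eilenberg differential $(d_{\mathrm{LR}}\omega)(v_0,\dots,v_n)=\sum_i(-1)^iv_i\cdot\omega(v_0,\dots,\hat v_i,\dots,v_n)+\sum_{i<j}(-1)^{i+j}\omega([v_i,v_j],v_0,\dots,\hat v_i,\dots,\hat v_j,\dots,v_n)$, and inner derivative $(\iota^{\mathrm{LR}}_v\omega)(v_1,\dots,v_{n-1})=\omega(v,v_1,\dots,v_{n-1})$.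
   Formalization: The Cartan calculus is also assumed to have Ω^0 = O_X with L_v f = v·f for functions f (otherwise d = 0, ι = 0 is a counterexample), and Lie-Rinehart forms are antisymmetric multilinear maps, which are the alternating ones when 2 is not a zero divisor in O_X. *)

(* Defs.v *)
From HB Require Import structures.
From mathcomp Require Import all_boot all_order all_algebra.
From mathcomp Require Import boolp classical_sets.

Set Implicit Arguments.
Unset Strict Implicit.
Unset Printing Implicit Defensive.

Import GRing.Theory.

Local Open Scope ring_scope.

(** * Categories, limits, finite products *)

Declare Scope cat_scope.
Delimit Scope cat_scope with cat.
Local Open Scope cat_scope.

Record category := Category {
  obj :> Type;
  hom : obj -> obj -> Type;
  idm : forall X, hom X X;
  comp : forall X Y Z, hom Y Z -> hom X Y -> hom X Z;
  comp1m : forall X Y (f : hom X Y), comp (idm Y) f = f;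
  compm1 : forall X Y (f : hom X Y), comp f (idm X) = f;
  compA : forall X Y Z W (h : hom Z W) (g : hom Y Z) (f : hom X Y),
    comp h (comp g f) = comp (comp h g) f }.

Arguments hom {_}.
Arguments idm {_}.
Notation "g ∘ f" := (comp g f) (at level 40, left associativity) : cat_scope.

Record endofunctor (C : category) := Endofunctor {
  fobj :> C -> C;
  fmap : forall X Y : C, hom X Y -> hom (fobj X) (fobj Y);
  fmap1 : forall X, fmap (idm X) = idm (fobj X);
  fmapM : forall X Y Z (g : hom Y Z) (f : hom X Y),
    fmap (g ∘ f) = fmap g ∘ fmap f }.

Definition is_iso (C : category) (X Y : C) (f : hom X Y) : Prop :=
  exists g : hom Y X, g ∘ f = idm X /\ f ∘ g = idm Y.

Definition is_terminal (C : category) (E : C) : Prop :=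
  forall Y : C, exists! u : hom Y E, True.

Definition is_product (C : category) (A B P : C)
    (p : hom P A) (q : hom P B) : Prop :=
  forall (Y : C) (f : hom Y A) (g : hom Y B),
    exists! u : hom Y P, p ∘ u = f /\ q ∘ u = g.

(* The square with top [t], left [l], right [r], bottom [b]. *)
Definition is_pullback (C : category) (P A B D : C)
    (t : hom P A) (l : hom P B) (r : hom A D) (b : hom B D) : Prop :=
  r ∘ t = b ∘ l /\
  forall (Y : C) (f : hom Y A) (g : hom Y B), r ∘ f = b ∘ g ->
    exists! u : hom Y P, t ∘ u = f /\ l ∘ u = g.

(* [P] with the projections [q] is the fiber product over [B] of copies of
   [p : A -> B] indexed by [I]. *)
Definition is_fibprod (C : category) (A B : C) (p : hom A B)
    (I : Type) (P : C) (q : I -> hom P A) : Prop :=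
  (forall i j, p ∘ q i = p ∘ q j) /\
  forall (Y : C) (f : I -> hom Y A), (forall i j, p ∘ f i = p ∘ f j) ->
    exists! u : hom Y P, forall i, q i ∘ u = f i.

Section ProductPairing.
Variables (C : category) (A B P : C) (p : hom P A) (q : hom P B).
Hypothesis H : is_product p q.

Lemma pairing_ex (Y : C) (f : hom Y A) (g : hom Y B) :
  exists u : hom Y P, p ∘ u = f /\ q ∘ u = g.
Proof. by have [u [hu _]] := H f g; exists u. Qed.

Definition pairing (Y : C) (f : hom Y A) (g : hom Y B) : hom Y P :=
  sval (cid (pairing_ex f g)).

Lemma pairing1 (Y : C) (f : hom Y A) (g : hom Y B) : p ∘ pairing f g = f.
Proof. by rewrite /pairing; case: cid => u []. Qed.

Lemma pairing2 (Y : C) (f : hom Y A) (g : hom Y B) : q ∘ pairing f g = g.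
Proof. by rewrite /pairing; case: cid => u []. Qed.

Lemma pairing_inj (Y : C) (u v : hom Y P) :
  p ∘ u = p ∘ v -> q ∘ u = q ∘ v -> u = v.
Proof.
move=> e1 e2; have [w [_ hw]] := H (p ∘ v) (q ∘ v).
by rewrite -(hw u) // -(hw v).
Qed.

Lemma pairing_comp (Y Z : C) (f : hom Y A) (g : hom Y B) (h : hom Z Y) :
  pairing f g ∘ h = pairing (f ∘ h) (g ∘ h).
Proof. by apply: pairing_inj; rewrite compA ?pairing1 ?pairing2. Qed.

End ProductPairing.

Record finite_products (C : category) := FiniteProducts {
  one : C;
  oneP : is_terminal one;
  cprod : C -> C -> C;
  fst : forall X Y, hom (cprod X Y) X;
  snd : forall X Y, hom (cprod X Y) Y;
  prodP : forall X Y, is_product (fst X Y) (snd X Y) }.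

Arguments oneP {C} _ _ : rename.
Arguments prodP {C} _ _ _ _ _ _ : rename.
Arguments fst {_ _ X Y}.
Arguments snd {_ _ X Y}.

Section FiniteProductsTheory.
Variables (C : category) (P : finite_products C).

Lemma bang_ex (X : C) : exists u : hom X (one P), True.
Proof. by have [u _] := oneP P X; exists u. Qed.

Definition bang (X : C) : hom X (one P) := sval (cid (bang_ex X)).

Lemma bang_uniq (X : C) (f g : hom X (one P)) : f = g.
Proof. by have [u [_ hu]] := oneP P X; rewrite -(hu f) // -(hu g). Qed.

Definition ppair (Y A B : C) (f : hom Y A) (g : hom Y B) : hom Y (cprod P A B) :=
  pairing (prodP P A B) f g.

Definition pmap (A B A' B' : C) (f : hom A A') (g : hom B B') :
    hom (cprod P A B) (cprod P A' B') :=
  ppair (f ∘ fst) (g ∘ snd).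

Lemma ppair_comp (Y Z A B : C) (f : hom Y A) (g : hom Y B) (h : hom Z Y) :
  ppair f g ∘ h = ppair (f ∘ h) (g ∘ h).
Proof. exact: pairing_comp. Qed.

End FiniteProductsTheory.

Arguments bang {C} P X.

(** * Rosický tangent structures *)

(* [Tk k X] is the [k]-fold fiber product T_k X. That T preserves it is stated
   as: T (T_k X), with the images of the projections, is a fiber product of
   T π; this is the same as the natural map ν_k being an isomorphism. *)
Record tangent_bundle (C : category) := TangentBundle {
  tfun :> endofunctor C;
  tproj : forall X : C, hom (tfun X) X;
  tproj_nat : forall (X Y : C) (f : hom X Y), f ∘ tproj X = tproj Y ∘ fmap tfun f;
  Tk : nat -> C -> C;
  Tkpr : forall (k : nat) (X : C), 'I_k -> hom (Tk k X) (tfun X);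
  TkP : forall (k : nat) (X : C), (0 < k)%N -> is_fibprod (tproj X) (@Tkpr k X);
  TTkP : forall (k : nat) (X : C), (0 < k)%N ->
    is_fibprod (fmap tfun (tproj X)) (fun i => fmap tfun (@Tkpr k X i)) }.

Arguments Tkpr {C} _ _ _ _ : rename.

Section T2.
Variables (C : category) (B : tangent_bundle C) (X : C).

Definition T2 : C := Tk B 2 X.
Definition Tpr1 : hom T2 (B X) := Tkpr B 2 X ord0.
Definition Tpr2 : hom T2 (B X) := Tkpr B 2 X ord_max.

Lemma Tpr_proj : tproj B X ∘ Tpr1 = tproj B X ∘ Tpr2.
Proof. by have [e _] := @TkP _ B 2 X isT; apply: e. Qed.

Lemma tpair_ex (Y : C) (a b : hom Y (B X)) : tproj B X ∘ a = tproj B X ∘ b ->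
  exists u : hom Y T2, Tpr1 ∘ u = a /\ Tpr2 ∘ u = b.
Proof.
move=> e; have [_ H] := @TkP _ B 2 X isT.
have [|u [hu _]] := H Y (fun i : 'I_2 => if i == ord0 then a else b).
  by move=> i j; case: ifP; case: ifP.
by exists u; split; [apply: (hu ord0)|apply: (hu ord_max)].
Qed.

Definition tpair (Y : C) (a b : hom Y (B X))
    (e : tproj B X ∘ a = tproj B X ∘ b) : hom Y T2 :=
  sval (cid (tpair_ex e)).

Lemma tpair1 (Y : C) (a b : hom Y (B X)) (e : tproj B X ∘ a = tproj B X ∘ b) :
  Tpr1 ∘ tpair e = a.
Proof. by rewrite /tpair; case: cid => u []. Qed.

Lemma tpair2 (Y : C) (a b : hom Y (B X)) (e : tproj B X ∘ a = tproj B X ∘ b) :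
  Tpr2 ∘ tpair e = b.
Proof. by rewrite /tpair; case: cid => u []. Qed.

Lemma tpair_inj (Y : C) (u v : hom Y T2) :
  Tpr1 ∘ u = Tpr1 ∘ v -> Tpr2 ∘ u = Tpr2 ∘ v -> u = v.
Proof.
move=> e1 e2; have [E H] := @TkP _ B 2 X isT.
have [|w [_ hw]] := H Y (fun i : 'I_2 => Tkpr B 2 X i ∘ v).
  by move=> i j; rewrite !compA (E i j).
have -> : v = w by rewrite (hw v).
symmetry; apply: hw => i; case: (unliftP ord0 i) => [j|] -> //.
by rewrite ord1 (_ : lift _ _ = ord_max) //; apply: val_inj.
Qed.

End T2.

Arguments Tpr1 {C B X}.
Arguments Tpr2 {C B X}.
Arguments tpair {C B X Y a b}.

(* In the equations below the compatibility proofs [e] required to form pairs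
   into T_2 are universally quantified; each such compatibility is derivable
   from the other axioms, so that no equation is vacuous. *)

Lemma T2map_compat (C : category) (B : tangent_bundle C) (X Y : C) (f : hom X Y) :
  tproj B Y ∘ (fmap B f ∘ @Tpr1 C B X) = tproj B Y ∘ (fmap B f ∘ @Tpr2 C B X).
Proof. by rewrite !compA -tproj_nat -!compA Tpr_proj. Qed.

Definition T2map (C : category) (B : tangent_bundle C) (X Y : C) (f : hom X Y) :
  hom (T2 B X) (T2 B Y) := tpair (T2map_compat B f).

(* A bundle of abelian groups; the group laws are stated on generalized
   elements [a : Y -> T X]. *)
Record tangent_group (C : category) := TangentGroup {
  tbundle :> tangent_bundle C;
  tzero : forall X : C, hom X (tbundle X);
  tadd : forall X : C, hom (T2 tbundle X) (tbundle X);
  topp : forall X : C, hom (tbundle X) (tbundle X);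
  tzero_nat : forall (X Y : C) (f : hom X Y),
    fmap tbundle f ∘ tzero X = tzero Y ∘ f;
  tadd_nat : forall (X Y : C) (f : hom X Y),
    fmap tbundle f ∘ tadd X = tadd Y ∘ T2map tbundle f;
  tproj_zero : forall X, tproj tbundle X ∘ tzero X = idm X;
  tproj_add : forall X, tproj tbundle X ∘ tadd X = tproj tbundle X ∘ Tpr1;
  tproj_opp : forall X, tproj tbundle X ∘ topp X = tproj tbundle X;
  taddA : forall (X Y : C) (a b c : hom Y (tbundle X))
    (e1 : tproj tbundle X ∘ a = tproj tbundle X ∘ b)
    (e2 : tproj tbundle X ∘ b = tproj tbundle X ∘ c)
    (e3 : tproj tbundle X ∘ (tadd X ∘ tpair e1) = tproj tbundle X ∘ c)
    (e4 : tproj tbundle X ∘ a = tproj tbundle X ∘ (tadd X ∘ tpair e2)),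
    tadd X ∘ tpair e3 = tadd X ∘ tpair e4;
  taddC : forall (X Y : C) (a b : hom Y (tbundle X))
    (e1 : tproj tbundle X ∘ a = tproj tbundle X ∘ b)
    (e2 : tproj tbundle X ∘ b = tproj tbundle X ∘ a),
    tadd X ∘ tpair e1 = tadd X ∘ tpair e2;
  tadd0 : forall (X Y : C) (a : hom Y (tbundle X))
    (e : tproj tbundle X ∘ (tzero X ∘ (tproj tbundle X ∘ a)) = tproj tbundle X ∘ a),
    tadd X ∘ tpair e = a;
  taddN : forall (X Y : C) (a : hom Y (tbundle X))
    (e : tproj tbundle X ∘ (topp X ∘ a) = tproj tbundle X ∘ a),
    tadd X ∘ tpair e = tzero X ∘ (tproj tbundle X ∘ a) }.

Section FiberwiseGroup.
Variables (C : category) (G : tangent_group C) (X Y : C).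
Implicit Types a b c : hom Y (G X).

Definition tsum a b (e : tproj G X ∘ a = tproj G X ∘ b) : hom Y (G X) :=
  tadd G X ∘ tpair e.

Lemma tsub_compat a b : tproj G X ∘ a = tproj G X ∘ b ->
  tproj G X ∘ a = tproj G X ∘ (topp G X ∘ b).
Proof. by rewrite (compA _ (topp G X)) tproj_opp. Qed.

Definition tsub a b (e : tproj G X ∘ a = tproj G X ∘ b) : hom Y (G X) :=
  tsum (tsub_compat e).

Lemma tproj_sum a b (e : tproj G X ∘ a = tproj G X ∘ b) :
  tproj G X ∘ tsum e = tproj G X ∘ a.
Proof. by rewrite /tsum compA tproj_add -compA tpair1. Qed.

Lemma tsum_eq a b a' b' (e : tproj G X ∘ a = tproj G X ∘ b)
    (e' : tproj G X ∘ a' = tproj G X ∘ b') :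
  a = a' -> b = b' -> tsum e = tsum e'.
Proof. by move=> ea eb; subst; rewrite (Prop_irrelevance e e'). Qed.

End FiberwiseGroup.

Lemma tsum_comp (C : category) (G : tangent_group C) (X Y Z : C)
    (a b : hom Y (G X)) (h : hom Z Y) (e : tproj G X ∘ a = tproj G X ∘ b)
    (e' : tproj G X ∘ (a ∘ h) = tproj G X ∘ (b ∘ h)) :
  tsum e ∘ h = tsum e'.
Proof.
rewrite /tsum -compA; congr (_ ∘ _).
by apply: tpair_inj; rewrite compA ?tpair1 ?tpair2.
Qed.

(* The sections of T X -> X along [x : Y -> X], an abelian group. *)
Section Fiber.
Variables (C : category) (G : tangent_group C) (X Y : C) (x : hom Y X).

Record fiber := Fiber {
  fsec :> hom Y (G X);
  fsecP : tproj G X ∘ fsec = x }.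

Lemma fiber_eq (a b : fiber) : fsec a = fsec b -> a = b.
Proof.
case: a b => [a aP] [b bP] /= e; subst b; by rewrite (Prop_irrelevance aP bP).
Qed.

HB.instance Definition _ := gen_eqMixin fiber.
HB.instance Definition _ := gen_choiceMixin fiber.

Lemma fcompat (a b : fiber) : tproj G X ∘ fsec a = tproj G X ∘ fsec b.
Proof. by rewrite !fsecP. Qed.

Lemma fzero_subproof : tproj G X ∘ (tzero G X ∘ x) = x.
Proof. by rewrite compA tproj_zero comp1m. Qed.
Definition fzero : fiber := Fiber fzero_subproof.

Lemma fopp_subproof (a : fiber) : tproj G X ∘ (topp G X ∘ fsec a) = x.
Proof. by rewrite compA tproj_opp fsecP. Qed.
Definition fopp (a : fiber) : fiber := Fiber (fopp_subproof a).

Lemma fadd_subproof (a b : fiber) : tproj G X ∘ tsum (fcompat a b) = x.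
Proof. by rewrite tproj_sum fsecP. Qed.
Definition fadd (a b : fiber) : fiber := Fiber (fadd_subproof a b).

Lemma faddA : associative fadd.
Proof.
move=> a b c; apply: fiber_eq => /=.
by rewrite /tsum; symmetry; apply: taddA; apply: fcompat.
Qed.

Lemma faddC : commutative fadd.
Proof. by move=> a b; apply: fiber_eq => /=; apply: taddC. Qed.

Lemma fadd0 : left_id fzero fadd.
Proof.
move=> a; apply: fiber_eq => /=.
have e0 : fsec fzero = tzero G X ∘ (tproj G X ∘ fsec a) by rewrite fsecP.
have e : tproj G X ∘ (tzero G X ∘ (tproj G X ∘ fsec a)) = tproj G X ∘ fsec a.
  by rewrite -e0; apply: fcompat.
by rewrite -[RHS](tadd0 e); apply: tsum_eq.
Qed.

Lemma faddN : left_inverse fzero fopp fadd.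
Proof.
move=> a; apply: fiber_eq => /=.
have e : tproj G X ∘ (topp G X ∘ fsec a) = tproj G X ∘ fsec a.
  by rewrite compA tproj_opp.
by rewrite -[in RHS](fsecP a) -(taddN e); apply: tsum_eq.
Qed.

HB.instance Definition _ := GRing.isZmodule.Build fiber faddA faddC fadd0 faddN.

Lemma fsecD (a b : fiber) (e : tproj G X ∘ fsec a = tproj G X ∘ fsec b) :
  fsec (a + b)%R = tsum e.
Proof. exact: tsum_eq. Qed.

Lemma fsecB (a b : fiber) (e : tproj G X ∘ fsec a = tproj G X ∘ fsec b) :
  fsec (a - b)%R = tsub e.
Proof. exact: tsum_eq. Qed.

Lemma fsec0 : fsec 0%R = tzero G X ∘ x.
Proof. by []. Qed.

End Fiber.

Lemma fpushP (C : category) (G : tangent_group C) (X X' Y : C) (x : hom Y X)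
    (f : hom X X') (a : fiber G x) :
  tproj G X' ∘ (fmap G f ∘ fsec a) = f ∘ x.
Proof. by rewrite compA -tproj_nat -compA fsecP. Qed.

Definition fpush (C : category) (G : tangent_group C) (X X' Y : C) (x : hom Y X)
  (f : hom X X') (a : fiber G x) : fiber G (f ∘ x) := Fiber (fpushP f a).

Lemma fpushD (C : category) (G : tangent_group C) (X X' Y : C) (x : hom Y X)
    (f : hom X X') (a b : fiber G x) :
  fpush f (a + b)%R = (fpush f a + fpush f b)%R.
Proof.
apply: fiber_eq; rewrite [RHS](fsecD (fcompat _ _)).
rewrite -[LHS]/(fmap G f ∘ tsum (fcompat a b)) /tsum compA tadd_nat -compA.
congr (_ ∘ _); apply: tpair_inj; rewrite compA ?tpair1 ?tpair2 -compA;
  by rewrite ?tpair1 ?tpair2.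
Qed.

Lemma fpushB (C : category) (G : tangent_group C) (X X' Y : C) (x : hom Y X)
    (f : hom X X') (a b : fiber G x) :
  fpush f (a - b)%R = (fpush f a - fpush f b)%R.
Proof. by apply: (addIr (fpush f b)); rewrite -fpushD !subrK. Qed.

Lemma tvert_compat (C : category) (B : tangent_bundle C) (X : C) :
  tproj B X ∘ tproj B (B X) = tproj B X ∘ fmap B (tproj B X).
Proof. exact: tproj_nat. Qed.

Record tangent_structure (C : category) := TangentStructure {
  tgroup :> tangent_group C;
  tlift : forall X : C, hom (tgroup X) (tgroup (tgroup X));
  tflip : forall X : C, hom (tgroup (tgroup X)) (tgroup (tgroup X));
  tlift_nat : forall (X Y : C) (f : hom X Y),
    fmap tgroup (fmap tgroup f) ∘ tlift X = tlift Y ∘ fmap tgroup f;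
  tflip_nat : forall (X Y : C) (f : hom X Y),
    fmap tgroup (fmap tgroup f) ∘ tflip X = tflip Y ∘ fmap tgroup (fmap tgroup f);
  tflipK : forall X, tflip X ∘ tflip X = idm (tgroup (tgroup X));
  tflip_braid : forall X,
    tflip (tgroup X) ∘ fmap tgroup (tflip X) ∘ tflip (tgroup X) =
    fmap tgroup (tflip X) ∘ tflip (tgroup X) ∘ fmap tgroup (tflip X);
  tproj_flip : forall X,
    tproj tgroup (tgroup X) ∘ tflip X = fmap tgroup (tproj tgroup X);
  (* precomposed with the isomorphism ν_2 *)
  tflip_add : forall (X : C)
    (e : tproj tgroup (tgroup X) ∘ (tflip X ∘ fmap tgroup (@Tpr1 C tgroup X)) =
         tproj tgroup (tgroup X) ∘ (tflip X ∘ fmap tgroup (@Tpr2 C tgroup X))),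
    tflip X ∘ fmap tgroup (tadd tgroup X) = tadd tgroup (tgroup X) ∘ tpair e;
  tproj_lift : forall X,
    tproj tgroup (tgroup X) ∘ tlift X = tzero tgroup X ∘ tproj tgroup X;
  tlift_coassoc : forall X,
    tlift (tgroup X) ∘ tlift X = fmap tgroup (tlift X) ∘ tlift X;
  tlift_add : forall (X : C)
    (e : tproj tgroup (tgroup X) ∘ (tlift X ∘ @Tpr1 C tgroup X) =
         tproj tgroup (tgroup X) ∘ (tlift X ∘ @Tpr2 C tgroup X)),
    tadd tgroup (tgroup X) ∘ tpair e = tlift X ∘ tadd tgroup X;
  tflip_lift : forall X, tflip X ∘ tlift X = tlift X;
  tflip_lift2 : forall X,
    fmap tgroup (tflip X) ∘ tflip (tgroup X) ∘ fmap tgroup (tlift X) =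
    tlift (tgroup X) ∘ tflip X;
  tlift_pullback : forall X,
    is_pullback (tlift X) (tproj tgroup X)
      (tpair (tvert_compat tgroup X))
      (tpair (erefl (tproj tgroup X ∘ tzero tgroup X))) }.

Section Lift2.
Variables (C : category) (T : tangent_structure C) (X : C).

Lemma tlift2_compat :
  tproj T (T X) ∘ (fmap T (tzero T X) ∘ Tpr1) =
  tproj T (T X) ∘ (tlift T X ∘ Tpr2).
Proof. by rewrite !compA -tproj_nat tproj_lift -!compA Tpr_proj. Qed.

Definition tlift2 : hom (T2 T X) (T (T X)) :=
  tflip T X ∘ (tadd T (T X) ∘ tpair tlift2_compat).

End Lift2.

Record cartesian_tangent_category := CartesianTangentCategory {
  ct_cat :> category;
  ct_tan : tangent_structure ct_cat;
  ct_prod : finite_products ct_cat;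
  ct_Tone : is_terminal (ct_tan (one ct_prod));
  ct_Tprod : forall X Y : ct_cat,
    is_product (fmap ct_tan (@fst ct_cat ct_prod X Y))
               (fmap ct_tan (@snd ct_cat ct_prod X Y)) }.

Arguments ct_Tprod : clear implicits.

Section Cartesian.
Variable C : cartesian_tangent_category.
Let T := ct_tan C.
Let P := ct_prod C.

(* The morphism (a, b) into TX × TY = T(X × Y). *)
Definition tppair (Z X Y : C) (a : hom Z (T X)) (b : hom Z (T Y)) :
    hom Z (T (cprod P X Y)) :=
  pairing (ct_Tprod C X Y) a b.

(* T_(1) f and T_(2) f *)
Definition tder1 (X Y Z : C) (f : hom (cprod P X Y) Z) :
    hom (cprod P (T X) Y) (T Z) :=
  fmap T f ∘ tppair fst (tzero T Y ∘ snd).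

Definition tder2 (X Y Z : C) (f : hom (cprod P X Y) Z) :
    hom (cprod P X (T Y)) (T Z) :=
  fmap T f ∘ tppair (tzero T X ∘ fst) snd.

End Cartesian.

(** * Scalar multiplication *)

(* Commutative ring objects; laws on generalized elements. *)
Record ring_object (C : category) (P : finite_products C) := RingObject {
  robj :> C;
  rzero : hom (one P) robj;
  rone : hom (one P) robj;
  ropp : hom robj robj;
  radd : hom (cprod P robj robj) robj;
  rmul : hom (cprod P robj robj) robj;
  raddA : forall (Y : C) (a b c : hom Y robj),
    radd ∘ ppair P a (radd ∘ ppair P b c) = radd ∘ ppair P (radd ∘ ppair P a b) c;
  raddC : forall (Y : C) (a b : hom Y robj), radd ∘ ppair P a b = radd ∘ ppair P b a;
  radd0 : forall (Y : C) (a : hom Y robj), radd ∘ ppair P (rzero ∘ bang P Y) a = a;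
  raddN : forall (Y : C) (a : hom Y robj),
    radd ∘ ppair P (ropp ∘ a) a = rzero ∘ bang P Y;
  rmulA : forall (Y : C) (a b c : hom Y robj),
    rmul ∘ ppair P a (rmul ∘ ppair P b c) = rmul ∘ ppair P (rmul ∘ ppair P a b) c;
  rmulC : forall (Y : C) (a b : hom Y robj), rmul ∘ ppair P a b = rmul ∘ ppair P b a;
  rmul1 : forall (Y : C) (a : hom Y robj), rmul ∘ ppair P (rone ∘ bang P Y) a = a;
  rmulD : forall (Y : C) (a b c : hom Y robj),
    rmul ∘ ppair P (radd ∘ ppair P a b) c =
    radd ∘ ppair P (rmul ∘ ppair P a c) (rmul ∘ ppair P b c) }.

Record scalar_multiplication (C : cartesian_tangent_category) :=
  ScalarMultiplication {
  sring :> ring_object (ct_prod C);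
  skappa : forall X : C, hom (cprod (ct_prod C) sring (ct_tan C X)) (ct_tan C X);
  skappa_nat : forall (X Y : C) (f : hom X Y),
    fmap (ct_tan C) f ∘ skappa X =
    skappa Y ∘ pmap (ct_prod C) (idm sring) (fmap (ct_tan C) f);
  skappa_proj : forall X, tproj (ct_tan C) X ∘ skappa X = tproj (ct_tan C) X ∘ snd;
  (* κ makes TX -> X a bundle of R-modules *)
  skappaA : forall (X Y : C) (r s : hom Y sring) (a : hom Y (ct_tan C X)),
    skappa X ∘ ppair _ r (skappa X ∘ ppair _ s a) =
    skappa X ∘ ppair _ (rmul sring ∘ ppair _ r s) a;
  skappa1 : forall (X Y : C) (a : hom Y (ct_tan C X)),
    skappa X ∘ ppair _ (rone sring ∘ bang _ Y) a = a;
  skappaDl : forall (X Y : C) (r s : hom Y sring) (a : hom Y (ct_tan C X))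
    (e : tproj (ct_tan C) X ∘ (skappa X ∘ ppair _ r a) =
         tproj (ct_tan C) X ∘ (skappa X ∘ ppair _ s a)),
    skappa X ∘ ppair _ (radd sring ∘ ppair _ r s) a = tsum e;
  skappaDr : forall (X Y : C) (r : hom Y sring) (a b : hom Y (ct_tan C X))
    (e1 : tproj (ct_tan C) X ∘ a = tproj (ct_tan C) X ∘ b)
    (e2 : tproj (ct_tan C) X ∘ (skappa X ∘ ppair _ r a) =
          tproj (ct_tan C) X ∘ (skappa X ∘ ppair _ r b)),
    skappa X ∘ ppair _ r (tsum e1) = tsum e2;
  (* R is tangent-stable *)
  seta : hom (ct_tan C sring) sring;
  seta_iso : is_iso (ppair (ct_prod C) (tproj (ct_tan C) sring) seta);
  seta_add : seta ∘ tadd (ct_tan C) sring =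
    radd sring ∘ ppair _ (seta ∘ Tpr1) (seta ∘ Tpr2);
  seta_zero : seta ∘ tzero (ct_tan C) sring = rzero sring ∘ bang _ sring;
  seta_kappa : seta ∘ skappa sring = rmul sring ∘ pmap _ (idm sring) seta;
  seta_Tadd : seta ∘ fmap (ct_tan C) (radd sring) =
    radd sring ∘ ppair _ (seta ∘ fmap (ct_tan C) fst) (seta ∘ fmap (ct_tan C) snd);
  seta_lift : seta ∘ fmap (ct_tan C) seta ∘ tlift (ct_tan C) sring = seta;
  (* compatibility of κ with the tangent structure; [r], [s], [snd] are the
     three projections of (R × R) × TX *)
  skappa_lift : forall X,
    skappa (ct_tan C X) ∘ pmap _ (idm sring) (tlift (ct_tan C) X) =
    tlift (ct_tan C) X ∘ skappa X;
  skappa_der1 : forall (X : C)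
    (r s : hom (cprod (ct_prod C) (cprod (ct_prod C) sring sring) (ct_tan C X)) sring)
    (e : tproj (ct_tan C) X ∘ (skappa X ∘ ppair (ct_prod C) r snd) =
         tproj (ct_tan C) X ∘ (skappa X ∘ ppair (ct_prod C) s snd)),
    r = fst ∘ fst -> s = snd ∘ fst ->
    tder1 (skappa X) =
    tlift2 (ct_tan C) X ∘ tpair e ∘
      pmap _ (ppair _ (tproj (ct_tan C) sring) seta) (idm (ct_tan C X));
  skappa_der2 : forall X,
    tder2 (skappa X) =
    tflip (ct_tan C) X ∘ skappa (ct_tan C X) ∘
      pmap _ (idm sring) (tflip (ct_tan C) X) }.

(** * Functions *)

Section Functions.
Variables (C : cartesian_tangent_category) (S : scalar_multiplication C) (X : C).

Definition functions : Type := hom X S.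

HB.instance Definition _ := gen_eqMixin functions.
HB.instance Definition _ := gen_choiceMixin functions.

Let P := ct_prod C.
Implicit Types f g h : functions.

Definition fun_zero : functions := rzero S ∘ bang P X.
Definition fun_one : functions := rone S ∘ bang P X.
Definition fun_opp f : functions := ropp S ∘ f.
Definition fun_add f g : functions := radd S ∘ ppair P f g.
Definition fun_mul f g : functions := rmul S ∘ ppair P f g.

Lemma fun_addA : associative fun_add.
Proof. by move=> f g h; apply: raddA. Qed.
Lemma fun_addC : commutative fun_add.
Proof. by move=> f g; apply: raddC. Qed.
Lemma fun_add0 : left_id fun_zero fun_add.
Proof. by move=> f; apply: radd0. Qed.
Lemma fun_addN : left_inverse fun_zero fun_opp fun_add.
Proof. by move=> f; apply: raddN. Qed.

HB.instance Definition _ :=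
  GRing.isZmodule.Build functions fun_addA fun_addC fun_add0 fun_addN.

Lemma fun_mulA : associative fun_mul.
Proof. by move=> f g h; apply: rmulA. Qed.
Lemma fun_mulC : commutative fun_mul.
Proof. by move=> f g; apply: rmulC. Qed.
Lemma fun_mul1 : left_id fun_one fun_mul.
Proof. by move=> f; apply: rmul1. Qed.
Lemma fun_mulD : left_distributive fun_mul +%R.
Proof. by move=> f g h; apply: rmulD. Qed.

HB.instance Definition _ :=
  GRing.Zmodule_isComPzRing.Build functions fun_mulA fun_mulC fun_mul1 fun_mulD.

End Functions.

(** * Vector fields *)

(* [S] does not matter for the type, but determines the module structure. *)
Definition vfield (C : cartesian_tangent_category)
    (S : scalar_multiplication C) (X : C) : Type := fiber (ct_tan C) (idm X).

Section VectorFields.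
Variables (C : cartesian_tangent_category) (S : scalar_multiplication C) (X : C).
Let T := ct_tan C.
Let P := ct_prod C.
Local Notation V := (vfield S X).

HB.instance Definition _ := GRing.Zmodule.on V.

Lemma vscale_subproof (f : functions S X) (v : V) :
  tproj T X ∘ (skappa S X ∘ ppair P f (fsec v)) = idm X.
Proof. by rewrite compA skappa_proj -compA /ppair pairing2 fsecP. Qed.
Definition vscale (f : functions S X) (v : V) : V := Fiber (vscale_subproof f v).

Lemma vscaleA (f g : functions S X) (v : V) :
  vscale f (vscale g v) = vscale (f * g) v.
Proof. by apply: fiber_eq; apply: skappaA. Qed.

Lemma vscale1 : left_id 1 vscale.
Proof. by move=> v; apply: fiber_eq; apply: skappa1. Qed.

Lemma vscaleDr : right_distributive vscale +%R.
Proof. by move=> f v w; apply: fiber_eq; apply: skappaDr. Qed.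

Lemma vscaleDl (v : V) : {morph vscale^~ v : f g / f + g}.
Proof. by move=> f g; apply: fiber_eq; apply: skappaDl. Qed.

HB.instance Definition _ :=
  GRing.Zmodule_isLmodule.Build (functions S X) V
    vscaleA vscale1 vscaleDr vscaleDl.

(* v · f = η ∘ Tf ∘ v *)
Definition vact (v : V) (f : functions S X) : functions S X :=
  seta S ∘ fmap T f ∘ fsec v.

Lemma bracket_proj1 (v w : V) :
  tproj T (T X) ∘ (fmap T (fsec w) ∘ fsec v) = fsec w.
Proof. by rewrite compA -tproj_nat -compA fsecP compm1. Qed.

Lemma bracket_proj2 (v w : V) :
  tproj T (T X) ∘ (tflip T X ∘ (fmap T (fsec v) ∘ fsec w)) = fsec w.
Proof. by rewrite !compA tproj_flip -fmapM fsecP fmap1 comp1m. Qed.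

Lemma bracket_compat (v w : V) :
  tproj T (T X) ∘ (fmap T (fsec w) ∘ fsec v) =
  tproj T (T X) ∘ (tflip T X ∘ (fmap T (fsec v) ∘ fsec w)).
Proof. by rewrite bracket_proj1 bracket_proj2. Qed.

Definition is_bracket (v w u : V) : Prop :=
  tsub (bracket_compat v w) = tlift2 T X ∘ tpair (fcompat w u).

(* The unique [u] with [is_bracket v w u], see [bracketP]. *)
Definition bracket (v w : V) : V := xget 0 [set u | is_bracket v w u]%classic.

Lemma tlift_inj (a b : V) : tlift T X ∘ fsec a = tlift T X ∘ fsec b -> a = b.
Proof.
move=> e; apply: fiber_eq.
have [E /(_ X (tlift T X ∘ fsec b) (idm X)) [|u [_ hu]]] := tlift_pullback T X.
  by rewrite compA E -compA fsecP.
by transitivity u; [symmetry|]; apply: hu; rewrite ?fsecP.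
Qed.

(* The two summands of λ_2 ∘ (w, u), in T(T X) as a group over T X by π_{TX}. *)
Lemma lift2_split (w u : V) :
  exists a b : fiber T (fsec (0 : V)),
  [/\ fsec a = fmap T (tzero T X) ∘ fsec w, fsec b = tlift T X ∘ fsec u &
      tlift2 T X ∘ tpair (fcompat w u) = tflip T X ∘ fsec (a + b)].
Proof.
have ha : tproj T (T X) ∘ (fmap T (tzero T X) ∘ fsec w) = fsec (0 : V).
  by rewrite compA -tproj_nat -compA fsecP.
have hb : tproj T (T X) ∘ (tlift T X ∘ fsec u) = fsec (0 : V).
  by rewrite compA tproj_lift -compA fsecP.
exists (Fiber ha), (Fiber hb); split => //.
rewrite /tlift2 -compA; congr (_ ∘ _).
have e : tproj T (T X) ∘ (fmap T (tzero T X) ∘ Tpr1 ∘ tpair (fcompat w u)) =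
         tproj T (T X) ∘ (tlift T X ∘ Tpr2 ∘ tpair (fcompat w u)).
  by rewrite -!compA tpair1 tpair2 ha hb.
rewrite (tsum_comp _ e); apply: tsum_eq; by rewrite /= -compA ?tpair1 ?tpair2.
Qed.

Lemma is_bracket_uniq (v w u u' : V) :
  is_bracket v w u -> is_bracket v w u' -> u = u'.
Proof.
rewrite /is_bracket => -> h.
have [a [b [ea eb e]]] := lift2_split w u.
have [a' [b' [ea' eb' e']]] := lift2_split w u'.
apply: tlift_inj; rewrite -eb -eb'; congr fsec; apply: (addrI a).
have -> : a + b = a' + b'.
  apply: fiber_eq; move: h; rewrite e e' => /(congr1 (fun t => tflip T X ∘ t)).
  by rewrite !compA tflipK !comp1m.
by congr (_ + _); apply: fiber_eq; rewrite ea ea'.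
Qed.

Lemma is_bracket_ex (v w : V) : exists u : V, is_bracket v w u.
Proof.
pose A := Fiber (bracket_proj1 v w); pose B := Fiber (bracket_proj2 v w).
pose z := A - B.
have ez : fsec z = tsub (bracket_compat v w) by exact: (@fsecB _ _ _ _ _ A B).
have zP : fmap T (tproj T X) ∘ fsec z = fsec (0 : V).
  rewrite -[LHS]/(fsec (fpush (tproj T X) z)) fpushB.
  have -> : fpush (tproj T X) A = fpush (tproj T X) B.
    apply: fiber_eq => /=; rewrite !compA -fmapM fsecP fmap1 comp1m.
    rewrite -(tproj_flip T X) -(compA _ (tflip T X) (tflip T X)) tflipK compm1.
    by rewrite -tproj_nat -compA fsecP compm1.
  by rewrite subrr /= fsecP.
have yP : tproj T (T X) ∘ (tflip T X ∘ fsec z) = fsec (0 : V).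
  by rewrite compA tproj_flip.
have cP : tproj T (T X) ∘ (fmap T (tzero T X) ∘ fsec w) = fsec (0 : V).
  by rewrite compA -tproj_nat -compA fsecP.
pose y := Fiber yP; pose c := Fiber cP; pose d := y - c.
have dP : fmap T (tproj T X) ∘ fsec d = tzero T X.
  rewrite -[LHS]/(fsec (fpush (tproj T X) d)) fpushB.
  have -> : fpush (tproj T X) y = fpush (tproj T X) c.
    apply: fiber_eq.
    rewrite -[LHS]/(fmap T (tproj T X) ∘ (tflip T X ∘ fsec z)).
    rewrite -[RHS]/(fmap T (tproj T X) ∘ (fmap T (tzero T X) ∘ fsec w)).
    have -> : fmap T (tproj T X) ∘ (fmap T (tzero T X) ∘ fsec w) = fsec w.
      by rewrite compA -fmapM tproj_zero fmap1 comp1m.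
    rewrite compA -(tproj_flip T X) -(compA _ (tflip T X) (tflip T X)) tflipK compm1.
    exact: fsecP.
  by rewrite subrr -[LHS]/(tzero T X ∘ (tproj T X ∘ fsec (0 : V))) fsecP compm1.
have [_ /(_ X (fsec d) (idm X))] := tlift_pullback T X.
case=> [|u [[ud uP] _]].
  rewrite compm1; apply: tpair_inj; rewrite compA ?tpair1 ?tpair2 //.
  by rewrite fsecP /= compm1.
exists (Fiber uP); have [a [b [ea eb e]]] := lift2_split w (Fiber uP).
rewrite /is_bracket e -ez.
have -> : a = c by apply: fiber_eq.
have -> : b = d by apply: fiber_eq; rewrite eb.
by rewrite addrC subrK -[fsec y]/(tflip T X ∘ fsec z) compA tflipK comp1m.
Qed.

Lemma bracketP (v w u : V) : is_bracket v w u <-> u = bracket v w.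
Proof.
have h : is_bracket v w (bracket v w).
  by apply: (@xgetPex _ 0 [set u | is_bracket v w u]%classic); apply: is_bracket_ex.
by split=> [/is_bracket_uniq/(_ h)|->].
Qed.

End VectorFields.

(** * Cartan calculi *)

(* Graded rings are represented by the total ring with an internal direct sum
   decomposition; [homog n] is the degree [n] component. *)
Record cdga := Cdga {
  cdga_ring :> pzRingType;
  homog : nat -> cdga_ring -> Prop;
  homog0 : forall n, homog n 0;
  homogB : forall n a b, homog n a -> homog n b -> homog n (a - b);
  homog1 : homog 0 1;
  homogM : forall p q a b, homog p a -> homog q b -> homog (p + q) (a * b);
  homog_span : forall a, exists (N : nat) (c : nat -> cdga_ring),
    (forall n, homog n (c n)) /\ a = \sum_(n < N) c n;
  homog_indep : forall (N : nat) (c : nat -> cdga_ring),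
    (forall n, homog n (c n)) -> \sum_(n < N) c n = 0 ->
    forall n, (n < N)%N -> c n = 0;
  gradedC : forall p q a b, homog p a -> homog q b ->
    a * b = (-1) ^+ (p * q) * (b * a);
  cdga_diff : cdga_ring -> cdga_ring;
  diffD : forall a b, cdga_diff (a + b) = cdga_diff a + cdga_diff b;
  diff_homog : forall n a, homog n a -> homog n.+1 (cdga_diff a);
  diffM : forall p a b, homog p a ->
    cdga_diff (a * b) = cdga_diff a * b + (-1) ^+ p * (a * cdga_diff b);
  diffK : forall a, cdga_diff (cdga_diff a) = 0 }.

(* The graded commutator of operators of degrees congruent to [p], [q] mod 2. *)
Definition gcomm (A : pzRingType) (p q : nat) (D E : A -> A) (a : A) : A :=
  D (E a) - (-1) ^+ (p * q) * E (D a).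

Record is_lie_bracket (M : zmodType) (br : M -> M -> M) : Prop := IsLieBracket {
  lieDl : forall u v w, br (u + v) w = br u w + br v w;
  lieDr : forall u v w, br u (v + w) = br u v + br u w;
  lieC : forall v w, br v w = - br w v;
  lieJ : forall u v w, br u (br v w) + br v (br w u) + br w (br u v) = 0 }.

(* A Cartan calculus whose degree 0 ring is [k] (identified by [cc_fun] with
   the degree 0 component), on the [k]-module [M] with bracket [br]. *)
Record cartan_calculus (k : comPzRingType) (M : lmodType k)
    (br : M -> M -> M) := CartanCalculus {
  cc_cdga :> cdga;
  cc_fun : {rmorphism k -> cc_cdga};
  cc_fun_inj : injective cc_fun;
  cc_funP : forall a, homog 0 a <-> exists f, a = cc_fun f;
  cc_lie_bracket : is_lie_bracket br;
  cc_iota : M -> cc_cdga -> cc_cdga;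
  iotaD : forall v a b, cc_iota v (a + b) = cc_iota v a + cc_iota v b;
  iota_homog : forall v n a, homog n.+1 a -> homog n (cc_iota v a);
  iota_homog0 : forall v a, homog 0 a -> cc_iota v a = 0;
  iotaM : forall v p a b, homog p a ->
    cc_iota v (a * b) = cc_iota v a * b + (-1) ^+ p * (a * cc_iota v b);
  iotaDl : forall v w a, cc_iota (v + w) a = cc_iota v a + cc_iota w a;
  iotaZl : forall f v a, cc_iota (f *: v) a = cc_fun f * cc_iota v a;
  cc_lie := fun v => gcomm 1 1 (cc_iota v) (@cdga_diff cc_cdga);
  iota_iota : forall v w a, gcomm 1 1 (cc_iota v) (cc_iota w) a = 0;
  lie_iota : forall v w a, gcomm 0 1 (cc_lie v) (cc_iota w) a = cc_iota (br v w) a;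
  lie_lie : forall v w a, gcomm 0 0 (cc_lie v) (cc_lie w) a = cc_lie (br v w) a;
  lie_diff : forall v a, gcomm 0 1 (cc_lie v) (@cdga_diff cc_cdga) a = 0 }.

Arguments bracket {C} S X v w.
Arguments vact {C} S X v f.
Arguments cc_fun {k M br} c.
Arguments cc_iota {k M br} c v.
Arguments cc_lie {k M br} c v.

(** * Lie-Rinehart forms *)

(* An element of the total space ⊕_n Hom_k(∧^n M, k) is represented by its
   values on all finite sequences, the degree [n] component being given by the
   values on sequences of length [n]. ∧^n is the exterior power in the sense of
   graded commutativity, x ∧ y = - y ∧ x. If 2 is not a zero divisor in [k],
   these are the alternating maps, see [lr_form_alternating]. *)
Record lr_form (k : comPzRingType) (M : lmodType k) := LRForm {
  lr_val :> seq M -> k;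
  lr_linear : forall (s1 s2 : seq M) (f : k) (v w : M),
    lr_val (s1 ++ (f *: v + w) :: s2) =
    f * lr_val (s1 ++ v :: s2) + lr_val (s1 ++ w :: s2);
  lr_antisym : forall (s1 s2 : seq M) (v w : M),
    lr_val (s1 ++ v :: w :: s2) = - lr_val (s1 ++ w :: v :: s2);
  lr_bounded : exists N : nat, forall s, (N <= size s)%N -> lr_val s = 0 }.

Lemma lr_form_alternating (k : comPzRingType) (M : lmodType k) (w : lr_form M) :
  (forall f : k, f + f = 0 -> f = 0) ->
  forall (s1 s2 s3 : seq M) (v : M), w (s1 ++ v :: s2 ++ v :: s3) = 0.
Proof.
move=> h2 s1 s2 s3 v; elim: s2 s1 => [|u s2 IH] s1 /=.
  by apply: h2; rewrite [X in X + _]lr_antisym addNr.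
by rewrite lr_antisym -cat_rcons IH oppr0.
Qed.

Section LieRinehart.
Variables (k : comPzRingType) (M : lmodType k).
Implicit Types (a b : seq M -> k) (s : seq M).

Definition lr_homog (n : nat) a : Prop := forall s, size s <> n -> a s = 0.

Definition lr_const (f : k) : seq M -> k := fun s => if s is [::] then f else 0.

(* A subset of the positions is encoded by a mask [m]: the true positions are
   the arguments of the left factor, the false ones those of the right factor.
   [shuffle_inv m] is the number of inversions of the resulting permutation. *)
Definition shuffle_inv (n : nat) (m : n.-tuple bool) : nat :=
  #|[set ij : 'I_n * 'I_n | (ij.1 < ij.2)%N && ~~ tnth m ij.1 && tnth m ij.2]|.

Definition lr_wedge a b : seq M -> k := fun s =>
  \sum_(m : (size s).-tuple bool)
    (-1) ^+ shuffle_inv m * (a (mask m s) * b (mask (map negb m) s)).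

Definition lr_iota (v : M) a : seq M -> k := fun s => a (v :: s).

Definition del (i : nat) s : seq M := take i s ++ drop i.+1 s.

Definition lr_diff (act : M -> k -> k) (br : M -> M -> M) a : seq M -> k :=
  fun s =>
    \sum_(i < size s) (-1) ^+ i * act (nth 0 s i) (a (del i s)) +
    \sum_(i < size s) \sum_(j < size s | (i < j)%N)
      (-1) ^+ (i + j) * a (br (nth 0 s i) (nth 0 s j) :: del i (del j s)).

(* Morphisms of graded k-algebras to the algebra of Lie-Rinehart forms. *)
Record lr_morphism (br : M -> M -> M) (Om : cartan_calculus br)
    (psi : Om -> lr_form M) : Prop := LRMorphism {
  lr_morphD : forall (a b : Om) (s : seq M), psi (a + b) s = psi a s + psi b s;
  lr_morphM : forall a b : Om, psi (a * b) =1 lr_wedge (psi a) (psi b);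
  lr_morph_fun : forall f, psi (cc_fun Om f) =1 lr_const f;
  lr_morph_homog : forall (n : nat) (a : Om), homog n a -> lr_homog n (psi a) }.

End LieRinehart.

(* Main.v *)
Require Import Defs.
From mathcomp Require Import all_boot all_algebra.
From mathcomp Require Import boolp.

(** In degree n the morphism must be
    psi(omega)(v_1, ..., v_n) = iota_{v_n} ... iota_{v_1} omega, by iterating its
    compatibility with iota; this gives uniqueness. With this formula, every
    identity to be checked is proved by removing the first vector field: the
    derivation property of iota_v matches the recursion of the shuffle product,
    and Cartan's formulas for [iota_v, d] and [L_v, iota_w] match
    d_LR iota_v + iota_v d_LR = L_v on Lie-Rinehart forms. *)

Set Implicit Arguments.
Unset Strict Implicit.
Unset Printing Implicit Defensive.

Import GRing.Theory.
Local Open Scope ring_scope.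

(** * Decompositions into homogeneous components *)

Section GradedRing.
Variable A : cdga.
Implicit Types (a b : A) (c : nat -> A).

Lemma homogD n a b : homog n a -> homog n b -> homog n (a + b).
Proof.
move=> ha hb; rewrite -[b]opprK; apply: homogB => //.
by rewrite -[- b]add0r; apply: homogB => //; apply: homog0.
Qed.

Lemma homog_ind (P : A -> Prop) :
  (forall n a, homog n a -> P a) -> (forall a b, P a -> P b -> P (a + b)) ->
  forall a, P a.
Proof.
move=> Ph PD a; have [N [c [hc ->]]] := homog_span a.
elim/big_ind: _ => // [|i _]; [exact: (Ph 0%N _ (homog0 A 0))|exact: Ph (hc i)].
Qed.

Lemma homog_sum_pad N N' c : (N <= N')%N ->
  \sum_(n < N) c n = \sum_(n < N') (if (n < N)%N then c n else 0).
Proof. by move=> le; rewrite (big_ord_widen _ _ le) big_mkcond. Qed.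

(** Padded to a common length, the two decompositions differ by a decomposition of 0, whose terms
    vanish by [homog_indep]. *)
Lemma homog_sum_eq0 N N' c c' :
  (forall n, homog n (c n)) -> (forall n, homog n (c' n)) ->
  \sum_(n < N.+1) c n = \sum_(n < N'.+1) c' n -> c 0%N = c' 0%N.
Proof.
move=> hc hc'; rewrite (homog_sum_pad _ (leq_maxl N.+1 N'.+1)).
rewrite [RHS](homog_sum_pad _ (leq_maxr N.+1 N'.+1)).
move/(congr1 (fun x => x - \sum_(n < maxn N.+1 N'.+1)
  (if (n < N'.+1)%N then c' n else 0))); rewrite subrr -sumrB.
set e := fun n => (if (n < N.+1)%N then c n else 0) -
  (if (n < N'.+1)%N then c' n else 0).
move/(@homog_indep A _ e) => h; apply/subr0_eq/(h _ 0%N).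
  by move=> n; apply: homogB; case: ifP => // _; apply: homog0.
by rewrite leq_max ltn0Sn.
Qed.

End GradedRing.

(** * The degree 0 component and iterated contraction *)

Section CartanCalculus.
Variables (k : comPzRingType) (M : lmodType k) (br : M -> M -> M).
Variable Om : cartan_calculus br.
Implicit Types (a b : Om) (f g : k) (v w : M) (s : seq M).

(** The bound [N.+1] keeps index 0 in the sum, so that [c 0] is always a genuine component of
    [a]. *)
Definition is_deg0_part a f : Prop := exists N (c : nat -> Om),
  [/\ forall n, homog n (c n), c 0%N = cc_fun Om f & a = \sum_(n < N.+1) c n].

Lemma is_deg0_part_ex a : exists f, is_deg0_part a f.
Proof.
have [N [c [hc ->]]] := homog_span a.
(* If [N] is 0, the value [c 0] is arbitrary and must be reset to 0. *)
pose c' n := if (n < N)%N then c n else 0.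
have hc' n : homog n (c' n) by rewrite /c'; case: ifP => // _; apply: homog0.
have [f ef] := (cc_funP (c' 0%N)).1 (hc' 0%N).
by exists f, N, c'; split=> //; apply: homog_sum_pad.
Qed.

Definition deg0_part a : k := sval (cid (is_deg0_part_ex a)).

Lemma deg0_partE a f : is_deg0_part a f -> deg0_part a = f.
Proof.
rewrite /deg0_part; case: cid => g /= [N [c [hc ec ->]]] [N' [c' [hc' ec' e]]].
by apply: (@cc_fun_inj _ _ _ Om); rewrite -ec -ec'; apply: homog_sum_eq0 e.
Qed.

Lemma deg0_part_fun f : deg0_part (cc_fun Om f) = f.
Proof.
apply: deg0_partE; exists 0%N, (fun n => if n is 0%N then cc_fun Om f else 0).
split=> [[|n]||]; last by rewrite big_ord1.
- by apply/cc_funP; exists f.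
- exact: homog0.
- by [].
Qed.

Lemma deg0_part_pos n a : homog n.+1 a -> deg0_part a = 0.
Proof.
move=> ha; apply: deg0_partE; exists n.+1, (fun m => if m == n.+1 then a else 0).
split=> [m||].
- by case: eqP => [->|_] //; apply: homog0.
- by rewrite rmorph0.
- by rewrite big_ord_recr /= eqxx big1 ?add0r // => i _; rewrite ltn_eqF.
Qed.

Lemma deg0_partD a b : deg0_part (a + b) = deg0_part a + deg0_part b.
Proof.
apply: deg0_partE; rewrite /deg0_part.
case: cid => f /= [N [c [hc ec ea]]]; case: cid => g /= [N' [c' [hc' ec' eb]]].
rewrite {a}ea {b}eb; exists (maxn N N'), (fun n => (if (n < N.+1)%N then c n else 0) +
  (if (n < N'.+1)%N then c' n else 0)); split.
- by move=> n; apply: homogD; case: ifP => // _; apply: homog0.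
- by rewrite /= ec ec' rmorphD.
- by rewrite big_split -!homog_sum_pad // ltnS ?leq_maxl ?leq_maxr.
Qed.

Lemma deg0_partMf f a : deg0_part (cc_fun Om f * a) = f * deg0_part a.
Proof.
elim/homog_ind: a => [[|n] a ha|a b IHa IHb]; last first.
- by rewrite mulrDr !deg0_partD IHa IHb mulrDr.
- rewrite (deg0_part_pos ha) mulr0; apply: (@deg0_part_pos n).
  by rewrite -[n.+1]add0n; apply: homogM => //; apply/cc_funP; exists f.
- by have [g ->] := (cc_funP a).1 ha; rewrite -rmorphM !deg0_part_fun.
Qed.

Lemma deg0_part_diff a : deg0_part (cdga_diff a) = 0.
Proof.
elim/homog_ind: a => [n a /diff_homog/deg0_part_pos //|a b IHa IHb].
by rewrite diffD deg0_partD IHa IHb addr0.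
Qed.

Lemma cc_lieE v a :
  cc_lie Om v a = cc_iota Om v (cdga_diff a) + cdga_diff (cc_iota Om v a).
Proof. by rewrite /cc_lie /gcomm mulN1r opprK. Qed.

Lemma cc_lieD v a b : cc_lie Om v (a + b) = cc_lie Om v a + cc_lie Om v b.
Proof. by rewrite !cc_lieE diffD !Defs.iotaD diffD addrACA. Qed.

Lemma diff0 : cdga_diff 0 = 0 :> Om.
Proof. by apply: (addIr (cdga_diff 0)); rewrite -diffD !add0r. Qed.

Lemma cc_lie_homog v n a : homog n a -> homog n (cc_lie Om v a).
Proof.
rewrite cc_lieE => ha; apply: homogD; first exact/iota_homog/diff_homog.
case: n ha => [|n] ha; last exact/diff_homog/iota_homog.
by rewrite iota_homog0 // diff0; apply: homog0.
Qed.

Lemma deg0_part_lie (act : M -> k -> k) :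
  (forall v f, cc_lie Om v (cc_fun Om f) = cc_fun Om (act v f)) ->
  forall v a, deg0_part (cc_lie Om v a) = act v (deg0_part a).
Proof.
move=> actE v a.
(* Additivity of [act v] is inherited from the Lie derivative through the injective [cc_fun]. *)
have actD f g : act v (f + g) = act v f + act v g.
  by apply: (@cc_fun_inj _ _ _ Om); rewrite rmorphD -!actE rmorphD cc_lieD.
have act0 : act v 0 = 0 by apply: (addIr (act v 0)); rewrite -actD !add0r.
elim/homog_ind: a => [[|n] a ha|a b IHa IHb].
- by have [f ->] := (cc_funP a).1 ha; rewrite actE !deg0_part_fun.
- by rewrite (deg0_part_pos (cc_lie_homog v ha)) (deg0_part_pos ha) act0.
- by rewrite cc_lieD [LHS]deg0_partD IHa IHb deg0_partD actD.
Qed.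

(** After contraction with n vectors, it is the degree n component of [a] that lands in degree 0;
    [deg0_part] thus selects it, and [a] may be inhomogeneous. *)
Definition contraction a s : k :=
  deg0_part (foldl (fun b v => cc_iota Om v b) a s).

Lemma contraction_cons a v s :
  contraction a (v :: s) = contraction (cc_iota Om v a) s.
Proof. by []. Qed.

Lemma contraction_cat a s1 s2 : contraction a (s1 ++ s2) =
  contraction (foldl (fun b v => cc_iota Om v b) a s1) s2.
Proof. by rewrite /contraction foldl_cat. Qed.

Lemma contractionD s a b : contraction (a + b) s = contraction a s + contraction b s.
Proof.
by elim: s a b => [|v s IH] a b; [exact: deg0_partD|rewrite !contraction_cons Defs.iotaD].
Qed.

Lemma contraction0 s : contraction 0 s = 0.
Proof. by apply: (addIr (contraction 0 s)); rewrite -contractionD !add0r. Qed.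

Lemma contractionN s a : contraction (- a) s = - contraction a s.
Proof. by apply: (addIr (contraction a s)); rewrite -contractionD !addNr contraction0. Qed.

Lemma contraction_sign n s a :
  contraction ((-1) ^+ n * a) s = (-1) ^+ n * contraction a s.
Proof.
by rewrite -signr_odd -[in RHS]signr_odd; case: odd; rewrite ?mul1r // !mulN1r contractionN.
Qed.

Lemma iotaMf v f a :
  cc_iota Om v (cc_fun Om f * a) = cc_fun Om f * cc_iota Om v a.
Proof.
have hf : homog 0 (cc_fun Om f) by apply/cc_funP; exists f.
by rewrite (iotaM v _ hf) iota_homog0 // mul0r add0r mul1r.
Qed.

Lemma contractionMf f s a : contraction (cc_fun Om f * a) s = f * contraction a s.
Proof.
by elim: s a => [|v s IH] a; [exact: deg0_partMf|rewrite !contraction_cons iotaMf].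
Qed.

Lemma iota0 v : cc_iota Om v 0 = 0.
Proof. by apply: (addIr (cc_iota Om v 0)); rewrite -Defs.iotaD !add0r. Qed.

(** Too few vectors leave a positive degree, which [deg0_part] kills; one too many contracts an
    element of degree 0. *)
Lemma contraction_homog n a : homog n a -> lr_homog n (contraction a).
Proof.
move=> ha s; elim: s n a ha => [|v s IH] [|n] a ha //.
- by move=> _; apply: deg0_part_pos ha.
- by rewrite contraction_cons iota_homog0 // contraction0.
- by move=> ne; apply: IH (iota_homog v ha) _ => e; apply: ne; rewrite /= e.
Qed.

Lemma contraction_linear a s1 s2 f v w :
  contraction a (s1 ++ (f *: v + w) :: s2) =
  f * contraction a (s1 ++ v :: s2) + contraction a (s1 ++ w :: s2).
Proof.
by rewrite !contraction_cat !contraction_cons Defs.iotaDl iotaZl contractionD contractionMf.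
Qed.

Lemma contraction_antisym a s1 s2 v w :
  contraction a (s1 ++ v :: w :: s2) = - contraction a (s1 ++ w :: v :: s2).
Proof.
rewrite !contraction_cat !contraction_cons -contractionN.
congr (contraction _ s2); apply/eqP; rewrite -addr_eq0; apply/eqP.
set b := foldl _ _ _.
(* Contractions are odd, so their graded commutator is the anticommutator. *)
by have := iota_iota w v b; rewrite /gcomm mulN1r opprK.
Qed.

Lemma contraction_bounded a :
  exists N : nat, forall s, (N <= size s)%N -> contraction a s = 0.
Proof.
have [N [c [hc ->]]] := homog_span a.
exists N => s le; elim/big_ind: _ => [|x y hx hy|i _]; first exact: contraction0.
  by rewrite contractionD hx hy addr0.
apply: (contraction_homog (hc i)) => e.
by have := ltn_ord i; rewrite -e ltnNge le.
Qed.

Definition contraction_form a : lr_form M :=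
  LRForm (contraction_linear a) (contraction_antisym a) (contraction_bounded a).

End CartanCalculus.

(** * Recursion of the shuffle product on the first argument *)

Section Wedge.
Variables (k : comPzRingType) (M : lmodType k).
Implicit Types (a b : seq M -> k) (s : seq M).

(** A false head forms an inversion with every true entry behind it; a true head forms none. *)
Lemma shuffle_inv_cons n (x : bool) (m : n.-tuple bool) :
  shuffle_inv [tuple of x :: m] = ((~~ x) * count id m + shuffle_inv m)%N.
Proof.
have E N (t : N.-tuple bool) : shuffle_inv t =
    (\sum_(i < N) \sum_(j < N) ((i < j) && ~~ tnth t i && tnth t j))%N.
  rewrite /shuffle_inv pair_big /= -sum1_card big_mkcond /=.
  by apply: eq_bigr => ij _; rewrite inE; case: ifP.
rewrite !E big_ord_recl; congr (_ + _)%N.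
  rewrite big_ord_recl /= add0n.
  rewrite (eq_bigr (fun j : 'I_n => (~~ x) * tnth m j)%N) => [|j _].
    rewrite -big_distrr /= -sum1_count big_tuple; congr (_ * _)%N.
    by rewrite [RHS]big_mkcond /=; apply: eq_bigr => i _; case: (tnth m i).
  by rewrite !tnthS tnth0 mulnb.
apply: eq_bigr => i _; rewrite big_ord_recl /= add0n; apply: eq_bigr => j _.
by rewrite !tnthS.
Qed.

Lemma big_tuple_bool_cons (V : nmodType) n (F : n.+1.-tuple bool -> V) :
  \sum_(m : n.+1.-tuple bool) F m =
  \sum_(m : n.-tuple bool) F [tuple of true :: m] +
  \sum_(m : n.-tuple bool) F [tuple of false :: m].
Proof.
rewrite (reindex (fun p : bool * n.-tuple bool => [tuple of p.1 :: p.2])) /=.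
  rewrite -(pair_big xpredT xpredT (fun (x : bool) (m : n.-tuple bool) => F [tuple of x :: m])) /=.
  by rewrite (bigD1 true) //= (big_pred1 false) // => -[].
exists (fun t => (thead t, [tuple of behead t])) => [[x m]|t] _ /=.
  by congr pair; apply: val_inj.
by rewrite [RHS]tuple_eta; apply: val_inj.
Qed.

Lemma lr_wedge_nil a b : lr_wedge a b [::] = a [::] * b [::].
Proof.
rewrite /lr_wedge (big_pred1 [tuple]) => [|m]; last by rewrite [m]tuple0; apply/esym/eqP.
rewrite /shuffle_inv (_ : [set _ | _] = set0) ?cards0 ?mul1r //.
by apply/setP => -[[]].
Qed.

(** The masks are split by their first bit. If [v] goes to [b], it jumps over all arguments of [a],
    whose number is [p] wherever [a] does not vanish. *)
Lemma lr_wedge_cons p a b v s : lr_homog p a ->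
  lr_wedge a b (v :: s) =
  lr_wedge (lr_iota v a) b s + (-1) ^+ p * lr_wedge a (lr_iota v b) s.
Proof.
move=> ha; rewrite /lr_wedge /= big_tuple_bool_cons; congr (_ + _).
  by apply: eq_bigr => m _; rewrite shuffle_inv_cons.
rewrite mulr_sumr; apply: eq_bigr => m _; rewrite shuffle_inv_cons mul1n /=.
case: (eqVneq (size (mask m s)) p) => [e|/eqP ne].
  by rewrite -e size_mask ?size_tuple // exprD -mulrA.
by rewrite (ha _ ne) !mul0r !mulr0.
Qed.

End Wedge.

(** * Cartan's formula for Lie-Rinehart forms *)

Section CartanFormula.
Variables (k : comPzRingType) (M : lmodType k).
Variables (act : M -> k -> k) (br : M -> M -> M).
Implicit Types (a : lr_form M) (s : seq M).

Definition lr_lie v (a : seq M -> k) s : k :=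
  act v (a s) -
  \sum_(j < size s) a (take j s ++ br v (nth 0 s j) :: drop j.+1 s).

Lemma lr_move a s1 s2 v s3 :
  a (s1 ++ v :: s2 ++ s3) = (-1) ^+ size s2 * a (s1 ++ s2 ++ v :: s3).
Proof.
elim: s2 s1 => [|w s2 IH] s1; first by rewrite mul1r.
by rewrite /= lr_antisym -cat_rcons IH cat_rcons exprS -mulrA mulN1r.
Qed.

(** The terms of the differential that involve position 0 through the action or the bracket make up
    the Lie derivative; all others are those of the differential of [lr_iota v a], with indices
    shifted. *)
Lemma lr_diff_cons a v s :
  lr_diff act br a (v :: s) = lr_lie v a s - lr_diff act br (lr_iota v a) s.
Proof.
rewrite /lr_diff /lr_lie /= !big_ord_recl /= /del /= mul1r.
rewrite opprD -!addrA; congr (_ + _); first by rewrite drop0.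
rewrite [RHS]addrCA; congr (_ + _).
  rewrite -sumrN; apply: eq_bigr => i _.
  by rewrite /bump /= add1n exprS mulN1r mulNr.
congr (_ + _).
  rewrite big_mkcond big_ord_recl /= add0r -sumrN; apply: eq_bigr => j _.
  rewrite /bump /= !add0n add1n drop0.
  (* Bringing the leading bracket back to place [j] costs (-1)^j, which against the sign (-1)^(j+1)
     of the pair (0, j+1) leaves -1. *)
  have /= -> := @lr_move a [::] (take j s) (br v s`_j) (drop j.+1 s).
  rewrite size_takel ?(ltnW (ltn_ord j)) // exprS mulN1r mulNr mulrA.
  by rewrite -exprMn mulrNN mulr1 expr1n mul1r.
rewrite -sumrN; apply: eq_bigr => i _.
rewrite -sumrN big_mkcond big_ord_recl /= add0r -big_mkcond /=.
apply: eq_bigr => j _.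
(* Shifting both indices preserves the sign; the minus comes from exchanging the bracket with
   [v]. *)
rewrite /bump /= !add0n !add1n addSn addnS !exprS !mulN1r opprK -mulrN.
congr (_ * _); exact: (lr_antisym a [::]).
Qed.

End CartanFormula.

(** * Contraction against product, Lie derivative and differential *)

Section Morphism.
Variables (k : comPzRingType) (M : lmodType k) (br : M -> M -> M).
Variables (Om : cartan_calculus br) (act : M -> k -> k).
Hypothesis actE : forall v f, cc_lie Om v (cc_fun Om f) = cc_fun Om (act v f).
Implicit Types (a b : Om) (s : seq M).

Lemma contractionM a b :
  contraction (a * b) =1 lr_wedge (contraction a) (contraction b).
Proof.
move=> s; elim: s a b => [|v s IH] a b.
  rewrite lr_wedge_nil /contraction /=.
  (* On the empty sequence the claim is multiplicativity of [deg0_part]: a factor of positive degree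
     contributes 0. *)
  elim/homog_ind: b => [[|n] b hb|b c IHb IHc]; last first.
  - by rewrite mulrDr !deg0_partD IHb IHc mulrDr.
  - rewrite (deg0_part_pos hb) mulr0.
    elim/homog_ind: a => [m a ha|a c IHa IHc]; last first.
      by rewrite mulrDl deg0_partD IHa IHc addr0.
    by apply: (@deg0_part_pos _ _ _ _ (m + n)); rewrite -addnS; apply: homogM.
  - have [f ->] := (cc_funP b).1 hb; rewrite deg0_part_fun.
    elim/homog_ind: a => [m a ha|a c IHa IHc]; last first.
      by rewrite mulrDl !deg0_partD IHa IHc mulrDl.
    rewrite (@gradedC _ m 0) //; last by apply/cc_funP; exists f.
    by rewrite muln0 mul1r deg0_partMf mulrC.
(* The sign (-1)^p in [iotaM] and [lr_wedge_cons] requires a homogeneous left factor. *)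
elim/homog_ind: a => [p a ha|a c IHa IHc].
  rewrite contraction_cons (iotaM v _ ha) contractionD contraction_sign !IH.
  by rewrite (lr_wedge_cons _ _ _ (contraction_homog ha)).
rewrite mulrDl contractionD IHa IHc /lr_wedge -big_split /=.
by apply: eq_bigr => m _; rewrite contractionD mulrDl mulrDr.
Qed.

Lemma contraction_fun f : contraction (cc_fun Om f) =1 lr_const f.
Proof.
case=> [|v s]; first exact: deg0_part_fun.
by rewrite contraction_cons iota_homog0 ?contraction0 //; apply/cc_funP; exists f.
Qed.

Lemma contraction_lie v a :
  contraction (cc_lie Om v a) =1 lr_lie act br v (contraction a).
Proof.
move=> s; elim: s a => [|w s IH] a.
  by rewrite /lr_lie big_ord0 subr0 -(deg0_part_lie actE).
(* The correction [cc_iota Om (br v w) a] yields the summand j = 0 of [lr_lie] on [w :: s]. *)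
have lieE : cc_iota Om w (cc_lie Om v a) =
    cc_lie Om v (cc_iota Om w a) - cc_iota Om (br v w) a.
  by rewrite -lie_iota /gcomm mul1r opprB addrC subrK.
rewrite contraction_cons lieE contractionD contractionN IH /lr_lie /=.
rewrite big_ord_recl /= drop0 opprD -addrA; congr (_ + _).
by rewrite addrC.
Qed.

(** Both sides obey the same Cartan formula, and on the empty sequence both vanish, since d raises
    degrees. *)
Lemma contraction_diff a :
  contraction (cdga_diff a) =1 lr_diff act br (contraction a).
Proof.
move=> s; elim: s a => [|v s IH] a.
  by rewrite /lr_diff !big_ord0 addr0; apply: deg0_part_diff.
rewrite (lr_diff_cons _ _ (contraction_form a)) -contraction_lie -IH cc_lieE.
by rewrite contractionD addrK.
Qed.

(** Compatibility with [cc_iota] reduces to the empty sequence, where only the degree 0 component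
    survives and [psi] is fixed by its values on functions. *)
Lemma contraction_unique (psi : Om -> lr_form M) : lr_morphism psi ->
  (forall v a, psi (cc_iota Om v a) =1 lr_iota v (psi a)) ->
  forall a, psi a =1 contraction a.
Proof.
move=> [psiD _ psi_fun psi_homog] psi_iota a s.
elim: s a => [|v s IH] a; last by rewrite contraction_cons -IH psi_iota.
elim/homog_ind: a => [[|n] a ha|a b IHa IHb].
- by have [f ->] := (cc_funP a).1 ha; rewrite psi_fun contraction_fun.
- by rewrite (psi_homog _ _ ha) // (contraction_homog ha).
- by rewrite psiD contractionD IHa IHb.
Qed.

End Morphism.

(** * Existence and uniqueness of the morphism *)

Lemma lr_form_eq (k : comPzRingType) (M : lmodType k) (a b : lr_form M) :
  a =1 b -> a = b.
Proof.
move=> /funext; case: a b => [a al aa ab] [b bl ba bb] /= e.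
by case: b / e in bl ba bb *; congr LRForm; apply: Prop_irrelevance.
Qed.

Theorem proposition5p10 (C : cartesian_tangent_category)
    (S : scalar_multiplication C) (X : C)
    (Om : cartan_calculus (bracket S X))
    (Om_act : forall (v : vfield S X) (f : functions S X),
      cc_lie Om v (cc_fun Om f) = cc_fun Om (vact S X v f)) :
  exists! psi : Om -> lr_form (vfield S X),
    [/\ lr_morphism psi,
        forall omega : Om,
          psi (cdga_diff omega) =1 lr_diff (vact S X) (bracket S X) (psi omega) &
        forall (v : vfield S X) (omega : Om),
          psi (cc_iota Om v omega) =1 lr_iota v (psi omega)].
Proof.
exists (@contraction_form _ _ _ Om); split; first split.
- split.
  + by move=> a b s; apply: contractionD.
  + exact: contractionM.
  + exact: contraction_fun.
  + exact: contraction_homog.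
- exact: contraction_diff.
(* Compatibility with [cc_iota] is the defining recursion of [contraction]. *)
- by [].
- move=> psi [psiM _ psi_iota]; apply/funext => a; apply: lr_form_eq => s.
  by rewrite (contraction_unique psiM psi_iota).
Qed.
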